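(* Let $R$ be a $um$-ring, $M$ an $R$-module, $N$ a proper submodule of $M$ and $\phi:S(M)\to S(M)\cup\{\emptyset\}$ a function. The following conditions are equivalent: (1) $N$ is a $\phi$-classical prime submodule of $M$; (2) for every $a,b\in R$, $(N:_M ab)=(\phi(N):_M ab)$ or $(N:_M ab)=(N:_M a)$ or $(N:_M ab)=(N:_M b)$; (3) for every $a,b\in R$ and every submodule $L$ of $M$, $abL\subseteq N$ and $abL\nsubseteq\phi(N)$ implies that $aL\subseteq N$ or $bL\subseteq N$; (4) for every $a\in R$ and every submodule $L$ of $M$ with $aL\nsubseteq N$, $(N:_R aL)=(\phi(N):_R aL)$ or $(N:_R aL)=(N:_R L)$; (5) for every $a\in R$, every ideal $I$ of $R$ and every submodule $L$ of $M$, $aIL\subseteq N$ and $aIL\nsubseteq\phi(N)$ implies that $aL\subseteq N$ or $IL\subseteq N$; (6) for every ideal $I$ of $R$ and every submodule $L$ of $M$ with $IL\nsubseteq N$, $(N:_R IL)=(\phi(N):_R IL)$ or $(N:_R IL)=(N:_R L)$; (7) for all ideals $I,J$ of $R$ and every submodule $L$ of $M$, $IJL\subseteq N$ and $IJL\nsubseteq\phi(N)$ implies that $IL\subseteq N$ or $JL\subseteq N$.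
   Context: All rings are commutative with nonzero identity and all modules are unitary. A $um$-ring is a ring $R$ such that any $R$-module which is equal to a finite union of submodules must be equal to one of them. $S(M)$ is the set of all submodules of $M$. Standing convention: $\phi(N)\subseteq N$ for every $N\in S(M)$. A proper submodule $N$ of $M$ is $\phi$-classical prime if whenever $a,b\in R$ and $m\in M$ with $abm\in N\setminus\phi(N)$, then $am\in N$ or $bm\in N$. For $X$ a submodule of $M$ or $X=\emptyset$: $(X:_M a)=\{m\in M\mid am\in X\}$ for $a\in R$; $(X:_R L)=\{r\in R\mid rL\subseteq X\}$ for a submodule $L$ of $M$ (so these sets are empty when $X=\emptyset$). *)

(* Defs.v *)
From HB Require Import structures.
From mathcomp Require Import all_boot all_algebra.
From mathcomp Require Import boolp classical_sets.

Set Implicit Arguments.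
Unset Strict Implicit.
Unset Printing Implicit Defensive.

Import GRing.Theory.
Local Open Scope ring_scope.
Local Open Scope classical_set_scope.

Record submod (R : comNzRingType) (M : lmodType R) := Submod {
  submod_set :> set M;
  submodP : submod_closed (mem submod_set)
}.

(* Ideals are the submodules of the regular module; R itself is allowed. *)
Notation ideal R := (submod (R^o)).

(* [option (submod M)] is S(M) ∪ {∅}: a submodule contains 0, so ∅ is new. *)
Definition osubmod_set (R : comNzRingType) (M : lmodType R)
  (X : option (submod M)) : set M := if X is Some K then K else set0.

Definition proper_submod (R : comNzRingType) (M : lmodType R) (N : submod M) :
    Prop :=
  (N : set M) <> setT.

(* The indices i range over the finite set {0, ..., n-1}. *)
Definition um_ring (R : comNzRingType) : Prop :=
  forall (M : lmodType R) (n : nat) (K : 'I_n -> submod M),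
    [set: M] = \bigcup_i (K i : set M) -> exists i, [set: M] = K i.

(* aL *)
Definition scale_set (R : comNzRingType) (M : lmodType R) (a : R) (L : set M) :
  set M := [set a *: x | x in L].

(* IL, the set of finite sums of products; for M = R^o, the ideal product. *)
Definition mul_set (R : comNzRingType) (M : lmodType R) (I : set R^o)
    (L : set M) : set M :=
  [set x | exists n (r : 'I_n -> R) (m : 'I_n -> M),
     (forall i, I (r i) /\ L (m i)) /\ x = \sum_(i < n) r i *: m i].

(* (X :_M a) *)
Definition colonM (R : comNzRingType) (M : lmodType R) (X : set M) (a : R) :
  set M := [set m | X (a *: m)].

(* (X :_R L) *)
Definition colonR (R : comNzRingType) (M : lmodType R) (X L : set M) :
  set R := [set r | scale_set r L `<=` X].

Definition phi_classical_prime (R : comNzRingType) (M : lmodType R)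
    (phi : submod M -> option (submod M)) (N : submod M) : Prop :=
  proper_submod N /\
  forall (a b : R) (m : M),
    (submod_set N `\` osubmod_set (phi N)) ((a * b) *: m) ->
    submod_set N (a *: m) \/ submod_set N (b *: m).

(* Main.v *)
(* For (1) => (2), the submodule (N : ab) is covered by (phi N : ab), (N : a)
   and (N : b), and the um-property applied to the module (N : ab) selects one
   of them.  For (3) => (4) and (5) => (6) the colon ideal on the left is covered
   by the two candidate ideals on the right, and no group is the union of two
   proper subgroups.  The remaining steps only say that a product of submodules
   lies in a submodule as soon as its generators do. *)
Require Import Defs.
From HB Require Import structures.
From mathcomp Require Import all_boot all_algebra.
From mathcomp Require Import boolp classical_sets.
From mathcomp Require Import ring.

Set Implicit Arguments.
Unset Strict Implicit.
Unset Printing Implicit Defensive.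

Import GRing.Theory.
Local Open Scope ring_scope.
Local Open Scope classical_set_scope.

(** * Submodules, colons and cyclic submodules *)

Lemma submod0 (R : comNzRingType) (M : lmodType R) (K : submod M) :
  submod_set K 0.
Proof. by have [/set_mem] := submodP K. Qed.

Lemma submod_lin (R : comNzRingType) (M : lmodType R) (K : submod M) a x y :
  submod_set K x -> submod_set K y -> submod_set K (a *: x + y).
Proof.
move=> /mem_set Kx /mem_set Ky.
by have [_ /(_ a x y Kx Ky)/set_mem] := submodP K.
Qed.

Lemma submodZ (R : comNzRingType) (M : lmodType R) (K : submod M) a x :
  submod_set K x -> submod_set K (a *: x).
Proof. by move=> Kx; rewrite -[_ *: _]addr0; apply/submod_lin/submod0. Qed.

Lemma submodD (R : comNzRingType) (M : lmodType R) (K : submod M) x y :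
  submod_set K x -> submod_set K y -> submod_set K (x + y).
Proof. by rewrite -{2}[x]scale1r; exact: submod_lin. Qed.

Lemma submodB (R : comNzRingType) (M : lmodType R) (K : submod M) x y :
  submod_set K x -> submod_set K y -> submod_set K (x - y).
Proof. by move=> Kx Ky; rewrite addrC -scaleN1r; exact: submod_lin. Qed.

Lemma submod_sum (R : comNzRingType) (M : lmodType R) (K : submod M) n
    (F : 'I_n -> M) :
  (forall i, submod_set K (F i)) -> submod_set K (\sum_(i < n) F i).
Proof.
by move=> KF; elim/big_ind: _ => //; [exact: submod0 | exact: submodD].
Qed.

Lemma submod_closedW (R : comNzRingType) (M : lmodType R) (X : set M) :
  X 0 -> (forall a x y, X x -> X y -> X (a *: x + y)) -> submod_closed (mem X).
Proof.
move=> X0 XD; split=> [|a x y /set_mem Xx /set_mem Xy]; apply/mem_set => //.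
exact: XD.
Qed.

Lemma colonM_closed (R : comNzRingType) (M : lmodType R) (K : submod M) a :
  submod_closed (mem (colonM K a)).
Proof.
apply: submod_closedW => [|c x y Kx Ky]; rewrite /colonM /=.
  by rewrite scaler0; exact: submod0.
by rewrite scalerDr scalerA mulrC -scalerA; exact: submod_lin.
Qed.

Definition colonM_submod (R : comNzRingType) (M : lmodType R) (K : submod M) a :
  submod M := Submod (colonM_closed K a).

Lemma colonRE (R : comNzRingType) (M : lmodType R) (X L : set M) r :
  colonR X L r <-> forall x, L x -> X (r *: x).
Proof.
split=> [XL x Lx | XL _ [x Lx <-]]; last exact: XL.
by apply: XL; exists x.
Qed.

Lemma colonR_closed (R : comNzRingType) (M : lmodType R) (K : submod M)
    (L : set M) : submod_closed (mem (colonR K L : set R^o)).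
Proof.
apply: submod_closedW => [|c x y /colonRE Kx /colonRE Ky].
  by apply/colonRE => z _; rewrite scale0r; exact: submod0.
apply/colonRE => z Lz; rewrite scalerDl -scalerA.
by apply: submod_lin; [exact: Kx | exact: Ky].
Qed.

Definition colonR_submod (R : comNzRingType) (M : lmodType R) (K : submod M)
  (L : set M) : ideal R := Submod (colonR_closed K L).

Lemma cyclic_closed (R : comNzRingType) (M : lmodType R) (m : M) :
  submod_closed (mem [set r *: m | r in [set: R]]).
Proof.
apply: submod_closedW => [|c _ _ [r _ <-] [s _ <-]].
  by exists 0; rewrite ?scale0r.
by exists (c * r + s); rewrite // scalerDl scalerA.
Qed.

(** Serves twice: over [R^o] it is the principal ideal of an element. *)
Definition cyclic_submod (R : comNzRingType) (M : lmodType R) (m : M) :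
  submod M := Submod (cyclic_closed m).

Lemma cyclic_submod_id (R : comNzRingType) (M : lmodType R) (m : M) :
  submod_set (cyclic_submod m) m.
Proof. by exists 1; rewrite ?scale1r. Qed.

(** * Products of a set of scalars with a set of vectors *)

Lemma mul_setZ (R : comNzRingType) (M : lmodType R) (I : set R^o) (L : set M)
    r m : I r -> L m -> mul_set I L (r *: m).
Proof.
move=> Ir Lm; exists 1%N, (fun=> r), (fun=> m).
by rewrite big_ord_recl big_ord0 addr0.
Qed.

Lemma mul_set0 (R : comNzRingType) (M : lmodType R) (I : set R^o) (L : set M) :
  mul_set I L 0.
Proof.
exists 0%N, (fun=> 0), (fun=> 0); split; first by case.
by rewrite big_ord0.
Qed.

Lemma mul_set_sub (R : comNzRingType) (M : lmodType R) (I : set R^o)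
    (L : set M) (K : submod M) :
  (forall r m, I r -> L m -> submod_set K (r *: m)) -> mul_set I L `<=` K.
Proof.
move=> KIL _ [n [r [m [rm ->]]]]; apply: submod_sum => i.
by apply: KIL; have [] := rm i.
Qed.

(** * Coverings of a submodule by submodules *)

Lemma submod_subU (R : comNzRingType) (M : lmodType R) (H A B : submod M) :
  H `<=` (A : set M) `|` (B : set M) -> H `<=` A \/ H `<=` B.
Proof.
move=> HAB; apply: contrapT => /not_orP[].
move=> /existsNP[x /not_implyP[Hx nAx]] /existsNP[y /not_implyP[Hy nBy]].
(* Now x lies in B but not in A, and y in A but not in B, so x + y can lie in neither of them. *)
have [//|Bx] := HAB _ Hx; have [Ay|//] := HAB _ Hy.
have [Axy|Bxy] := HAB _ (submodD Hx Hy).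
  by apply: nAx; rewrite -[x](addrK y); exact: submodB.
by apply: nBy; rewrite -[y](addrK x) [y + x]addrC; exact: submodB.
Qed.

Lemma submod_eqU (R : comNzRingType) (M : lmodType R) (H A B : submod M) :
  A `<=` H -> B `<=` H -> H `<=` (A : set M) `|` (B : set M) ->
  H = A :> set M \/ H = B :> set M.
Proof.
by move=> AH BH /submod_subU[HA|HB]; [left | right]; exact/seteqP.
Qed.

Definition submod_pred (R : comNzRingType) (M : lmodType R) (H : submod M) :
  {pred M} := mem (submod_set H).

HB.instance Definition _ (R : comNzRingType) (M : lmodType R) (H : submod M) :=
  GRing.isSubmodClosed.Build R M (submod_pred H) (submodP H).

(** The um-property speaks of modules, which are types; this subtype turns the submodule H into such
    a module. *)
Record submod_type (R : comNzRingType) (M : lmodType R) (H : submod M) :=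
  SubmodElt { submod_val : M; _ : submod_val \in submod_pred H }.

HB.instance Definition _ (R : comNzRingType) (M : lmodType R) (H : submod M) :=
  [isSub for @submod_val R M H].
HB.instance Definition _ (R : comNzRingType) (M : lmodType R) (H : submod M) :=
  [Choice of submod_type H by <:].
HB.instance Definition _ (R : comNzRingType) (M : lmodType R) (H : submod M) :=
  [SubChoice_isSubLmodule of submod_type H by <:].

Lemma preim_closed (R : comNzRingType) (M : lmodType R) (H K : submod M) :
  submod_closed (mem [set x : submod_type H | submod_set K (val x)]).
Proof.
apply: submod_closedW => [|a x y Kx Ky]; rewrite /mkset.
  by rewrite raddf0; exact: submod0.
by rewrite linearP; exact: submod_lin.
Qed.

(** The um-property is applied to H as a module in its own right, covered by the traces on H of the
    [K i]. *)
Lemma um_ring_cover (R : comNzRingType) (M : lmodType R) (H : submod M) n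
    (K : 'I_n -> submod M) :
  um_ring R -> H `<=` \bigcup_i (K i : set M) -> exists i, H `<=` K i.
Proof.
move=> R_um HK.
have [|i Ki] := R_um (submod_type H) n (fun i => Submod (preim_closed H (K i))).
  apply/esym/seteqP; split=> // x _.
  have [i _ Kx] := HK _ (set_mem (valP x)).
  by exists i.
exists i => x /mem_set Hx.
have : [set: submod_type H] (SubmodElt Hx) by [].
by rewrite Ki.
Qed.

Lemma um_ring_eqU3 (R : comNzRingType) (M : lmodType R) (H A B C : submod M) :
  um_ring R -> A `<=` H -> B `<=` H -> C `<=` H ->
  (forall x, submod_set H x ->
     [\/ submod_set A x, submod_set B x | submod_set C x]) ->
  [\/ H = A :> set M, H = B :> set M | H = C :> set M].
Proof.
move=> R_um AH BH CH HABC.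
(* The default [A] is never reached, as the index is below 3. *)
pose K (i : 'I_3) := nth A [:: A; B; C] i.
have [|[[|[|[|//]]] lti] /= HK] := um_ring_cover (K := K) R_um (H := H).
- move=> x /HABC[Ax|Bx|Cx].
  + by exists (inord 0) => //; rewrite /K inordK.
  + by exists (inord 1) => //; rewrite /K inordK.
  + by exists (inord 2) => //; rewrite /K inordK.
- by apply: Or31; exact/seteqP.
- by apply: Or32; exact/seteqP.
- by apply: Or33; exact/seteqP.
Qed.

(** Common core of (3) => (4) and (5) => (6), with P = aL or P = IL. If X is a submodule, the ideal
    (N : P) is the union of (X : P) and (N : L), hence equal to one of them. If X is empty, rP is
    never inside X because P contains 0, so the last hypothesis puts all of (N : P) in (N : L). *)
Lemma colonR_eq (R : comNzRingType) (M : lmodType R) (N : submod M)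
    (X : option (submod M)) (L P : set M) :
  osubmod_set X `<=` N -> P 0 -> (forall r, colonR N L r -> colonR N P r) ->
  (forall r, colonR N P r -> ~ (scale_set r P `<=` osubmod_set X) ->
     colonR N L r) ->
  colonR N P = colonR (osubmod_set X) P \/ colonR N P = colonR N L.
Proof.
move=> XN P0 LP cov; case: X XN cov => [K|] /= KN cov; last first.
  right; apply/seteqP; split=> // r NPr; apply: cov => // /(_ (r *: 0)).
  by apply; exists 0.
apply: (@submod_eqU R R^o (colonR_submod N P) (colonR_submod K P)
          (colonR_submod N L)) => // r /=.
  by move=> KP x /KP/KN.
move=> NPr; have [?|/cov] := pselect (scale_set r P `<=` K); first by left.
by right; auto.
Qed.

(** The set rP contains r0, so it cannot lie in the empty set. This excludes an empty value of phi
    in (4) => (5) and (6) => (7). *)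
Lemma colonR_osubmod (R : comNzRingType) (M : lmodType R)
    (X : option (submod M)) (P : set M) r :
  P 0 -> colonR (osubmod_set X) P r ->
  exists K : submod M, osubmod_set X = submod_set K.
Proof. by move=> P0 /colonRE/(_ 0 P0); case: X => [K _|//]; exists K. Qed.

Lemma scale_mul_set_sub (R : comNzRingType) (M : lmodType R) (K : submod M) a
    (I : ideal R) (L : set M) :
  I `<=` colonR K (scale_set a L) -> scale_set a (mul_set I L) `<=` K.
Proof.
move=> IK _ [y ILy <-]; move: y ILy.
(* The vectors that a sends into K form a submodule, so only the generators of IL need checking. *)
apply: (mul_set_sub (K := colonM_submod K a)) => r m /IK/colonRE Kr Lm.
by rewrite /= /colonM /= scalerA mulrC -scalerA; apply: Kr; exists m.
Qed.

(** Reassociation of (IJ)L as I(JL): an element of IJ is a sum of products rs, and (rs)m = r(sm)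
    with sm in JL. *)
Lemma mul_mul_set_sub (R : comNzRingType) (M : lmodType R) (K : submod M)
    (I J : ideal R) (L : set M) :
  I `<=` colonR K (mul_set J L) -> mul_set (mul_set I J) L `<=` K.
Proof.
move=> IK; apply: mul_set_sub => _ m [n [r [s [rs ->]]]] Lm.
rewrite scaler_suml; apply: submod_sum => i; have [Ir Js] := rs i.
by rewrite -scalerA; move/colonRE: (IK _ Ir); apply; exact: mul_setZ.
Qed.

(** * The cycle of implications *)

Theorem theorem2p14 (R : comNzRingType) (M : lmodType R) (N : submod M)
    (phi : submod M -> option (submod M))
    (R_um : um_ring R)
    (N_proper : proper_submod N)
    (phi_sub : forall K : submod M, osubmod_set (phi K) `<=` K) :
  [<-> (* 1 *) phi_classical_prime phi N;
   (* 2 *) forall a b : R,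
     [\/ colonM N (a * b) = colonM (osubmod_set (phi N)) (a * b),
         colonM N (a * b) = colonM N a
       | colonM N (a * b) = colonM N b];
   (* 3 *) forall (a b : R) (L : submod M),
     scale_set (a * b) L `<=` N -> ~ (scale_set (a * b) L `<=` osubmod_set (phi N)) ->
     scale_set a L `<=` N \/ scale_set b L `<=` N;
   (* 4 *) forall (a : R) (L : submod M), ~ (scale_set a L `<=` N) ->
     colonR N (scale_set a L) = colonR (osubmod_set (phi N)) (scale_set a L) \/
     colonR N (scale_set a L) = colonR N L;
   (* 5 *) forall (a : R) (I : ideal R) (L : submod M),
     scale_set a (mul_set I L) `<=` N ->
     ~ (scale_set a (mul_set I L) `<=` osubmod_set (phi N)) ->
     scale_set a L `<=` N \/ mul_set I L `<=` N;
   (* 6 *) forall (I : ideal R) (L : submod M), ~ (mul_set I L `<=` N) ->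
     colonR N (mul_set I L) = colonR (osubmod_set (phi N)) (mul_set I L) \/
     colonR N (mul_set I L) = colonR N L;
   (* 7 *) forall (I J : ideal R) (L : submod M),
     mul_set (mul_set I J) L `<=` N ->
     ~ (mul_set (mul_set I J) L `<=` osubmod_set (phi N)) ->
     mul_set I L `<=` N \/ mul_set J L `<=` N].
have N0 := submod0 N; have phiN := @phi_sub N.
tfae.
- move=> [_ N_prime] a b.
  have NaN c d : colonM_submod N c `<=` colonM_submod N (c * d).
    by move=> x Nx; rewrite /= /colonM /= mulrC -scalerA; exact: submodZ.
  have cov x : colonM N (a * b) x -> ~ colonM (osubmod_set (phi N)) (a * b) x ->
      colonM N a x \/ colonM N b x by move=> Nx phix; exact: N_prime.
  case: (phi N) phiN cov => [K|] /= KN cov.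
    apply: (@um_ring_eqU3 R M (colonM_submod N (a * b)) (colonM_submod K (a * b))
              (colonM_submod N a) (colonM_submod N b)) => //.
    + by move=> x /KN.
    + by rewrite mulrC.
    + move=> x Nx; have [Kx|/(cov x Nx)[?|?]] := pselect (colonM K (a * b) x).
      * exact: Or31.
      * exact: Or32.
      * exact: Or33.
  (* Here phi(N) is empty, so (N : a) and (N : b) alone cover (N : ab). *)
  have [| | |Na|Nb] := @submod_eqU R M (colonM_submod N (a * b))
    (colonM_submod N a) (colonM_submod N b).
  + exact: NaN.
  + by rewrite mulrC; exact: NaN.
  + by move=> x Nx; apply: cov.
  + exact: Or32.
  + exact: Or33.
- move=> N_colon a b L NabL phiabL.
  (* Read abL ⊆ N as L ⊆ (N : ab), then replace this colon by each of its three possible values. *)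
  have LN x : submod_set L x -> colonM N (a * b) x.
    by move=> Lx; apply: NabL; exists x.
  have [E|E|E] := N_colon a b.
  + by case: phiabL => _ [x /LN + <-]; rewrite E.
  + by left=> _ [x /LN + <-]; rewrite E.
  + by right=> _ [x /LN + <-]; rewrite E.
- move=> N3 a L NaL; apply: colonR_eq => //.
  + by exists 0; rewrite ?scaler0 //; exact: submod0.
  + move=> r /colonRE NrL; apply/colonRE => _ [x Lx <-].
    by rewrite scalerA mulrC -scalerA; apply/submodZ/NrL.
  have raL r : scale_set r (scale_set a L) = scale_set (r * a) L.
    apply/seteqP; split=> [_ [_ [x Lx <-] <-]|_ [x Lx <-]].
      by exists x; rewrite ?scalerA.
    by exists (a *: x); [exists x | rewrite scalerA].
  (* Condition (3) for the pair r, a gives rL ⊆ N or aL ⊆ N, and the latter is excluded. *)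
  move=> r; rewrite /colonR /= raL => NraL phiraL.
  by have [] := N3 _ _ _ NraL phiraL.
- move=> N4 a I L NaIL phiaIL.
  have [|NaL] := pselect (scale_set a L `<=` N); [by left | right].
  have aL0 : scale_set a L 0.
    by exists 0; rewrite ?scaler0 //; exact: submod0.
  (* By (4), I then lies in (phi(N) : aL), against the assumption on aIL, or in (N : L), which is
     the goal. *)
  have IN : I `<=` colonR N (scale_set a L).
    move=> r Ir; apply/colonRE => _ [x Lx <-]; apply: NaIL.
    by exists (r *: x); [exact: mul_setZ | rewrite !scalerA mulrC].
  have [E|E] := N4 a L NaL; rewrite E in IN.
    have [K phiK] := colonR_osubmod aL0 (IN _ (submod0 I)).
    by case: phiaIL; move: IN; rewrite phiK; exact: scale_mul_set_sub.
  by apply: mul_set_sub => r m /IN/colonRE; exact.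
- move=> N5 I L NIL; apply: colonR_eq => //.
  + exact: mul_set0.
  + move=> r /colonRE NrL; apply/colonRE.
    apply: (mul_set_sub (K := colonM_submod N r)) => s m _ Lm.
    by rewrite /= /colonM /= scalerA mulrC -scalerA; apply/submodZ/NrL.
  (* Condition (5) with r as the scalar leaves rL ⊆ N, since IL ⊆ N is excluded. *)
  + by move=> r NrIL phirIL; have [] := N5 _ _ _ NrIL phirIL.
- move=> N6 I J L NIJL phiIJL.
  have [|NJL] := pselect (mul_set J L `<=` N); [by right | left].
  (* Condition (6) is used for J and L, and I is then located in one of the two colon ideals. *)
  have IN : I `<=` colonR N (mul_set J L).
    move=> r Ir; apply/colonRE => _ [n [s [m [sm ->]]]].
    rewrite scaler_sumr; apply: submod_sum => i; have [Js Lm] := sm i.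
    by rewrite scalerA; apply: NIJL; apply: mul_setZ => //; exact: mul_setZ.
  have [E|E] := N6 J L NJL; rewrite E in IN.
    have [K phiK] := colonR_osubmod (mul_set0 J L) (IN _ (submod0 I)).
    by case: phiIJL; move: IN; rewrite phiK; exact: mul_mul_set_sub.
  by apply: mul_set_sub => r m /IN/colonRE; exact.
- move=> N7; split=> // a b m [Nabm phiabm].
  have cycN (c : R) : mul_set (cyclic_submod (c : R^o)) (cyclic_submod m) `<=` N ->
      submod_set N (c *: m).
    by apply; apply: mul_setZ; exact: cyclic_submod_id.
  (* Apply (7) to Ra, Rb and Rm: their product consists of multiples of abm, hence lies in N, and it
     contains abm itself, hence is not inside phi(N). *)
  have [||Na|Nb] := N7 (cyclic_submod (a : R^o)) (cyclic_submod (b : R^o))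
    (cyclic_submod m).
  + apply: mul_mul_set_sub => _ [r _ <-]; apply/colonRE.
    apply: (mul_set_sub (K := colonM_submod N (r * a))) => _ _ [s _ <-] [t _ <-].
    rewrite /= /colonM /= !scalerA.
    have -> : r * a * (s *: (b : R^o)) * t = r * s * t * (a * b).
      (* Scaling in [R^o] is multiplication in R; this must be made visible to [ring]. *)
      by rewrite -[s *: _]/(s * b); ring.
    by rewrite -scalerA; exact: submodZ.
  + move=> phiN'; apply: phiabm; apply: phiN'.
    apply: mul_setZ; last exact: cyclic_submod_id.
    by apply: (mul_setZ (M := R^o)); exact: cyclic_submod_id.
  + by left; exact: cycN.
  + by right; exact: cycN.
Qed.
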